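(* Suppose that the choice functions $C_f$, $f\in F$, satisfy the gapless condition (C). Let $\mathcal T=(x^1,\ldots,x^N)$ be a non-excessive route. Then: (i) any rotation occurs in $\mathcal T$ at most once; and (ii) $N=O(|V|\,|E|^2)$ (with an absolute constant).
   Context: Setting. $G=(V,E)$ is a finite connected bipartite graph without multiple edges, $V$ partitioned into independent sets $W$ (workers) and $F$ (firms). $E_v$ is the set of edges incident to $v$; $wf$ denotes the edge joining $w\in W$, $f\in F$. There are capacities $b:E\to\mathbb Z_+$ and quotas $q:W\to\mathbb Z_+$. $\mathcal B=\{x\in\mathbb Z_+^E: x\le b\}$; $\mathcal B_v$ is the set of restrictions of members of $\mathcal B$ to $E_v$; $x_v$ is the restriction of $x$ to $E_v$. For $z\ge 0$, $|z|=\sum_e z(e)$. $\wedge,\vee$ are coordinatewise min and max; $\mathbf 1^e$ is the unit vector of $e$; $\mathrm{supp}(z)=\{e: z(e)\neq 0\}$. Choice functions $C_v:\mathcal B_v\to\mathcal B_v$. Each $w\in W$ has a strict linear order $>_w$ on $E_w$ ($e>_w e'$: $e$ is preferred to $e'$), and $C_w(z)=z$ if $|z|\le q(w)$; if $|z|>q(w)$, number $E_w$ as $e_1>_we_2>_w\cdots$, take the maximal $j$ with $r:=\sum_{i\le j}z(e_i)\le q(w)$ and let $C_w(z)=(z(e_1),\ldots,z(e_j),q(w)-r,0,\ldots,0)$. Each $f\in F$ has a $C_f$ with $C_f(z)\le z$ such that for all $z\ge z'$ in $\mathcal B_f$: (A1) $z'\ge C_f(z)$ implies $C_f(z')=C_f(z)$;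 (A2) $C_f(z)\wedge z'\le C_f(z')$; (A3) $|C_f(z)|\ge|C_f(z')|$. $\mathcal A_v=\{z\in\mathcal B_v: C_v(z)=z\}$ (acceptable). For distinct $z,z'\in\mathcal A_v$: $z'\prec_v z$ iff $C_v(z\vee z')=z$. A g-allocation is $x\in\mathcal B$ with $x_v\in\mathcal A_v$ for all $v\in V$. For distinct g-allocations, $x\prec_F y$ iff $x_f\preceq_f y_f$ for all $f\in F$. For $z\in\mathcal A_v$, $e\in E_v$ is interesting for $v$ under $z$ if there is $z'\in\mathcal B_v$ with $z'(e)>z(e)$, $z'(e')=z(e')$ for $e'\ne e$, and $C_v(z')(e)>z(e)$; ''interesting for $v$ under $x$'' means under $x_v$. An edge $wf$ blocks $x$ if it is interesting under $x$ for both $w$ and $f$. A g-allocation is stable if no edge blocks it; $\mathcal S$ is the set of stable g-allocations. It is known that $(\mathcal S,\prec_F)$ is a nonempty distributive lattice, that $x\prec_F y$ in $\mathcal S$ implies $C_w(x_w\vee y_w)=x_w$ for all $w\in W$, and that $|x_v|$ is the same for all $x\in\mathcal S$, for each $v\in V$. Rotations. Let $x\in\mathcal S$ and $W^==\{w\in W:|x_w|=q(w)\}$. For $w\in W^=$ let $\ell_w(x)$ be the least preferred edge (under $>_w$) of $\mathrm{supp}(x_w)$. The most preferred edge (if any) among the edges $e=wf\in E_w$ with $e\le_w\ell_w(x)$ and $e$ interesting for $f$ under $x$ is called $W$-admissible and denoted $a_w(x)$ (there is none if $x_w=0$). For a $W$-admissible $a=wf$, $C_f(x_f+\mathbf 1^a)$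 equals $x_f+\mathbf 1^a$ or $x_f+\mathbf 1^a-\mathbf 1^c$ for some $c\in E_f\setminus\{a\}$; in the latter case $c$ is called $F$-admissible, associated with $a$, and $(a,c)$ is a tandem for $x$ passing $f$. $D(x)$ is the directed graph on $V$ whose edges are the $W$-admissible edges directed from $W$ to $F$ and the $F$-admissible edges directed from $F$ to $W$. Cleaning: while some $w\in W$ has a leaving edge $a=(w,f)$ but no entering edge, delete $a$, and also delete the edge $c$ associated with $a$ (if exists) when $c$ is in no other tandem passing $f$ in the current graph; remove isolated vertices. The final graph is the active graph $\Gamma(x)$. In it each vertex of $W$ has exactly one entering and one leaving edge, and at each vertex $f\in F$ the tandems passing $f$ are edge-disjoint and partition the edges of $\Gamma(x)$ at $f$. Hence $\Gamma(x)$ decomposes uniquely into edge-disjoint directed edge-simple cycles in which consecutive edges at each $f\in F$ form a tandem; these cycles are the rotations generated by (applicable to) $x$, and $\mathcal L(x)$ is their set. Rotations for different $x$ are compared as directed cycles (cyclic edge sequences). For a rotation $L$, $L^+$ (resp. $L^-$) is the set of its edges directed from $W$ to $F$ (resp. from $F$ to $W$), identified with the underlying edges of $G$. $\chi^A\in\mathbb R^E$ is the 0/1 incidence vector of $A\subseteq E$. Weights and routes. $\lambda\in\mathbb Z_{>0}$ is feasible for $L\in\mathcal L(x)$ if $\lambda\le x(e)$ for all $e\in L^-$, $\lambda\le b(e)-x(e)$ for all $e\in L^+$, and $C_f(x_f+\lambda\mathbf 1^a)=x_f+\lambda\mathbf 1^a-\lambda\mathbf 1^c$ for each $f\in F$ and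 each tandem $(a,c)$ in $L$ passing $f$. Shifting $x$ along $L$ with weight $\lambda$ means replacing $x$ by $x+\lambda(\chi^{L^+}-\chi^{L^-})$ (which is again in $\mathcal S$ for feasible $\lambda$). For $x,y\in\mathcal S$ with $x\prec_F y$, a route from $x$ to $y$ is a sequence $x=x^1,x^2,\ldots,x^N=y$ in $\mathcal S$ where each $x^{i+1}$ is obtained from $x^i$ by shifting along some $L^i\in\mathcal L(x^i)$ with a feasible weight $\lambda_i$; the rotations $L^i$ are said to occur in the route. The route is non-excessive if at each step $\lambda_i$ is the maximal possible weight, i.e. the largest feasible weight $\lambda$ for $L^i$ at $x^i$ such that $x^i+\lambda(\chi^{L^{i+}}-\chi^{L^{i-}})\preceq_F y$. Gapless condition (C). For $f\in F$ and $z\in\mathcal A_f$, a pair $(a,c)$ in $E_f$ is an (abstract) tandem for $z$ if $z(a)<b(a)$, $z(c)>0$ and $C_f(z+\mathbf 1^a)=z+\mathbf 1^a-\mathbf 1^c$. Condition (C): for each $f\in F$, if $z^1,z^2,z^3\in\mathcal A_f$ and $a,c^1,c^2,c^3\in E_f$ are such that $z^1\prec_f z^2\prec_f z^3$, $(a,c^i)$ is a tandem for $z^i$ ($i=1,2,3$), and $c^1=c^3$, then $c^1=c^2$. *)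

(* Defs.v *)
From mathcomp Require Import all_boot.
Set Implicit Arguments.
Unset Strict Implicit.
Unset Printing Implicit Defensive.

(* [pref w e e'] is e >_w e'; only its values on edges incident to w matter,
   and only the values of [cfirm f] on vectors of B_f matter. *)
Record market := Market {
  worker : finType;
  firm : finType;
  edge : finType;
  ew : edge -> worker;
  ef : edge -> firm;
  cap : {ffun edge -> nat};
  quota : worker -> nat;
  pref : worker -> rel edge;
  cfirm : firm -> {ffun edge -> nat} -> {ffun edge -> nat}
}.

Section Definitions.
Variable M : market.

Local Notation vec := {ffun edge M -> nat}.
Local Notation b := (@cap M).

Definition vertex := (worker M + firm M)%type.

Definition incident (v : vertex) (e : edge M) : bool :=
  match v with inl w => ew e == w | inr f => ef e == f end.

Definition adjacent : rel vertex :=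
  [rel u v | (u != v) && [exists e, incident u e && incident v e]].

(** Vectors.  An element of Z_+^{E_v} is encoded as a vector on the whole
    edge set that vanishes outside E_v. *)

Definition vle (z z' : vec) : bool := [forall e, z e <= z' e].
Definition vmin (z z' : vec) : vec := [ffun e => minn (z e) (z' e)].
Definition vmax (z z' : vec) : vec := [ffun e => maxn (z e) (z' e)].
Definition norm (z : vec) : nat := \sum_e z e.

Definition restr (v : vertex) (x : vec) : vec :=
  [ffun e => if incident v e then x e else 0].

Definition in_B (v : vertex) (z : vec) : bool := vle z b && (restr v z == z).

Definition set_at (z : vec) (e : edge M) (k : nat) : vec :=
  [ffun e' => if e' == e then k else z e'].

(* z + k 1^a *)
Definition add_at (z : vec) (k : nat) (a : edge M) : vec :=
  [ffun e => z e + k * (e == a)].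

(* z + k 1^a - k 1^c.  Subtraction on nat is truncated, so this is the
   intended vector only when it is nonnegative; every use below comes with a
   condition k <= z c. *)
Definition exchange (z : vec) (k : nat) (a c : edge M) : vec :=
  [ffun e => z e + k * (e == a) - k * (e == c)].

(** Choice functions *)

(* The edges e_1, ..., e_j are those with [upto e <= quota w]; for e_(j+1),
   [above e] is the r of the definition. *)
Definition cworker (w : worker M) (z : vec) : vec :=
  let above e := \sum_(e' | (ew e' == w) && pref w e' e) z e' in
  let upto e := above e + z e in
  if norm z <= quota w then z
  else [ffun e =>
    if ew e != w then 0
    else if upto e <= quota w then z e
    else if above e <= quota w then quota w - above e
    else 0].

Definition choice (v : vertex) (z : vec) : vec :=
  match v with inl w => cworker w z | inr f => cfirm f z end.

Definition acceptable (v : vertex) (z : vec) : bool :=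
  in_B v z && (choice v z == z).

(* z' precedes z *)
Definition vprec (v : vertex) (z' z : vec) : bool :=
  (z' != z) && (choice v (vmax z z') == z).

Definition vpreceq (v : vertex) (z' z : vec) : bool :=
  (z' == z) || vprec v z' z.

(** Standing assumptions *)

Record well_formed : Prop := WellFormed {
  no_multiple_edges :
    forall e e' : edge M, ew e = ew e' -> ef e = ef e' -> e = e';
  graph_connected : forall u v : vertex, connect adjacent u v;
  pref_irr : forall w (e : edge M), ew e = w -> ~~ pref w e e;
  pref_trans : forall w (e1 e2 e3 : edge M),
    ew e1 = w -> ew e2 = w -> ew e3 = w ->
    pref w e1 e2 -> pref w e2 e3 -> pref w e1 e3;
  pref_total : forall w (e e' : edge M),
    ew e = w -> ew e' = w -> e != e' -> pref w e e' || pref w e' e;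
  cfirm_le : forall f z, in_B (inr f) z -> vle (cfirm f z) z;
  cfirm_A1 : forall f z z', in_B (inr f) z -> in_B (inr f) z' ->
    vle z' z -> vle (cfirm f z) z' -> cfirm f z' = cfirm f z;
  cfirm_A2 : forall f z z', in_B (inr f) z -> in_B (inr f) z' ->
    vle z' z -> vle (vmin (cfirm f z) z') (cfirm f z');
  cfirm_A3 : forall f z z', in_B (inr f) z -> in_B (inr f) z' ->
    vle z' z -> norm (cfirm f z') <= norm (cfirm f z)
}.

(** Stability *)

Definition g_allocation (x : vec) : bool :=
  vle x b && [forall v, acceptable v (restr v x)].

(* The vectors z' in B_v that differ from z only at e are the
   [set_at z e k] with k <= b e. *)
Definition interesting (v : vertex) (z : vec) (e : edge M) : bool :=
  incident v e &&
  [exists k : 'I_(b e).+1, (z e < k) && (z e < choice v (set_at z e k) e)].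

Definition blocks (x : vec) (e : edge M) : bool :=
  interesting (inl (ew e)) (restr (inl (ew e)) x) e &&
  interesting (inr (ef e)) (restr (inr (ef e)) x) e.

Definition stable (x : vec) : bool :=
  g_allocation x && [forall e, ~~ blocks x e].

Definition precF (x y : vec) : bool :=
  (x != y) &&
  [forall f, vpreceq (inr f) (restr (inr f) x) (restr (inr f) y)].

Definition preceqF (x y : vec) : bool := (x == y) || precF x y.

(** Admissible edges and the graph D(x) *)

Definition fully_filled (x : vec) (w : worker M) : bool :=
  norm (restr (inl w) x) == quota w.

(* l is the edge ell_w(x) *)
Definition is_last (x : vec) (w : worker M) (l : edge M) : bool :=
  [&& ew l == w, x l != 0 &
      [forall e, (ew e == w) && (x e != 0) ==> (e == l) || pref w e l]].

Definition W_candidate (x : vec) (w : worker M) (e : edge M) : bool :=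
  [&& fully_filled x w, ew e == w,
      [exists l, is_last x w l && ((e == l) || pref w l e)] &
      interesting (inr (ef e)) (restr (inr (ef e)) x) e].

(* a = a_w(x) for the worker w incident to a *)
Definition W_admissible (x : vec) (a : edge M) : bool :=
  W_candidate x (ew a) a &&
  [forall e, W_candidate x (ew a) e ==> (e == a) || pref (ew a) a e].

Definition tandem (x : vec) (a c : edge M) : bool :=
  let z := restr (inr (ef a)) x in
  [&& W_admissible x a, ef c == ef a, c != a, 1 <= z c &
      cfirm (ef a) (add_at z 1 a) == exchange z 1 a c].

Definition F_admissible (x : vec) (c : edge M) : bool :=
  [exists a, tandem x a c].

(* [inl a] is the edge a directed from W to F, [inr c] is the edge c directed
   from F to W.  A directed graph without isolated vertices is given by its
   set of directed edges. *)
Definition dedge := (edge M + edge M)%type.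

Definition D (x : vec) : {set dedge} :=
  [set d : dedge | match d with
                   | inl a => W_admissible x a
                   | inr c => F_admissible x c
                   end].

(** Cleaning and the active graph *)

Definition in_other_tandem (x : vec) (G : {set dedge}) (a c : edge M) : bool :=
  [exists a', [&& a' != a, tandem x a' c, inl a' \in G & inr c \in G]].

Definition deleted (x : vec) (G : {set dedge}) (a : edge M) : {set dedge} :=
  [set d : dedge | match d with
                   | inl a' => a' == a
                   | inr c => tandem x a c && ~~ in_other_tandem x G a c
                   end].

Definition cleaning_step (x : vec) : rel {set dedge} :=
  [rel G G' : {set dedge} | [exists a,
    [&& inl a \in G,
        [forall c, (inr c \in G) ==> (ew c != ew a)] &
        G' == G :\: deleted x G a]]].

(* G is a possible outcome of the cleaning procedure applied to D(x) *)
Definition active_graph (x : vec) (G : {set dedge}) : bool :=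
  connect (cleaning_step x) (D x) G && [forall G', ~~ cleaning_step x G G'].

(** Rotations *)

Definition consecutive (x : vec) (d d' : dedge) : bool :=
  match d, d' with
  | inl a, inr c => tandem x a c
  | inr c, inl a => ew c == ew a
  | _, _ => false
  end.

(* A directed edge-simple cycle is given by the sequence of its edges, starting
   from any of them. *)
Definition rotation (x : vec) (L : seq dedge) : bool :=
  [exists G, active_graph x G &&
    [&& L != [::], uniq L, all [in G] L & cycle (consecutive x) L]].

Definition same_rotation (L L' : seq dedge) : Prop :=
  exists n : nat, L' = rot n L.

Definition Lplus (L : seq dedge) : {set edge M} := [set e | inl e \in L].
Definition Lminus (L : seq dedge) : {set edge M} := [set e | inr e \in L].

(* Truncated subtraction is harmless here: for feasible weights k <= x e on
   [Lminus L]. *)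
Definition shift (x : vec) (L : seq dedge) (k : nat) : vec :=
  [ffun e => x e + k * (e \in Lplus L) - k * (e \in Lminus L)].

Definition feasible (x : vec) (L : seq dedge) (k : nat) : Prop :=
  [/\ 0 < k,
      forall e, e \in Lminus L -> k <= x e,
      forall e, e \in Lplus L -> k <= b e - x e &
      forall a c : edge M, inl a \in L -> next L (inl a) = inr c ->
        let z := restr (inr (ef a)) x in
        cfirm (ef a) (add_at z k a) = exchange z k a c].

(** Routes.  The members x^1, ..., x^N of a route are xs 0, ..., xs N.-1;
    for i.+1 < N, xs i.+1 is obtained from xs i by shifting along Ls i with
    weight ks i.  Other values of xs, Ls and ks are irrelevant. *)

Definition route (x y : vec) (N : nat) (xs : nat -> vec)
    (Ls : nat -> seq dedge) (ks : nat -> nat) : Prop :=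
  [/\ [/\ stable x, stable y & precF x y],
      xs 0 = x /\ xs N.-1 = y,
      forall i, i < N -> stable (xs i) &
      forall i, i.+1 < N ->
        [/\ rotation (xs i) (Ls i), feasible (xs i) (Ls i) (ks i) &
            xs i.+1 = shift (xs i) (Ls i) (ks i)]].

Definition max_weight (x y : vec) (L : seq dedge) (k : nat) : Prop :=
  [/\ feasible x L k, preceqF (shift x L k) y &
      forall k', feasible x L k' -> preceqF (shift x L k') y -> k' <= k].

Definition non_excessive_route (x y : vec) (N : nat) (xs : nat -> vec)
    (Ls : nat -> seq dedge) (ks : nat -> nat) : Prop :=
  route x y N xs Ls ks /\
  forall i, i.+1 < N -> max_weight (xs i) y (Ls i) (ks i).

(** The gapless condition (C) *)

Definition abstract_tandem (f : firm M) (z : vec) (a c : edge M) : Prop :=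
  [/\ ef a = f /\ ef c = f, z a < b a, 1 <= z c &
      cfirm f (add_at z 1 a) = exchange z 1 a c].

Definition gapless : Prop :=
  forall (f : firm M) (z1 z2 z3 : vec) (a c1 c2 c3 : edge M),
    acceptable (inr f) z1 -> acceptable (inr f) z2 -> acceptable (inr f) z3 ->
    vprec (inr f) z1 z2 -> vprec (inr f) z2 z3 ->
    abstract_tandem f z1 a c1 -> abstract_tandem f z2 a c2 ->
    abstract_tandem f z3 a c3 ->
    c1 = c3 -> c1 = c2.

End Definitions.

(* Main.v *)
Require Import Defs.
From mathcomp Require Import all_boot.
From mathcomp Require Import zify.

Set Implicit Arguments.
Unset Strict Implicit.
Unset Printing Implicit Defensive.

(** Both parts rest on one fact ([exists_last_use]): for every step [i] of a
    non-excessive route, some pair (a, c) of consecutive edges of the rotation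
    used at step [i] is used by no later rotation.  A rotation occurring twice
    would violate this at its first occurrence, which is (i).  Choosing such a
    pair for each step is injective, so N - 1 <= |E|^2; as the graph then has a
    worker and a firm, N <= |V| |E|^2, which is (ii) with constant 1.

    To see the fact, write x = x^i, L = L^i, k = k_i and suppose that every
    pair (a, c) of L is used again, at a step j > i depending on the pair.  At
    the firm f of such a pair, let u = C_f(x_f + k 1^a) = x_f + k 1^a - k 1^c.
    Then x_f < u <= x^j_f in the order of f.  All members of the route have the
    same total at f ([offer_shift]), so from (a, c) being a tandem at x^j_f,
    (A3) makes C_f(u + 1^a) discard some edge c' as well
    ([exchanges_persist]).  Thus (a, c), (a, c'), (a, c) are tandems for
    x_f < u <= x^j_f, and the gapless condition gives c' = c (if u = x^j_f then
    c' = c at once; see [recurrent_exchanges]).  By path independence the weight k + 1 is then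
    feasible for L at x ([exchanges_iterate]).  The shift with this weight also
    stays below y: edge by edge, the vector offered to f is bounded by x or by
    x^(j+1), both of which are below y.  This contradicts the maximality
    of k.

    The order of a firm is handled through the relation [dominated f z y],
    C_f(z v y) = y, for arbitrary vectors z.  For fixed y the vectors it admits
    form a set that is closed downwards, under coordinatewise maxima, and under
    passing from C_f(z) back to z. *)

(** * Vectors *)

Section Vectors.
Variable M : market.
Local Notation vec := {ffun edge M -> nat}.

Lemma vleP (z z' : vec) : reflect (forall e, z e <= z' e) (vle z z').
Proof. exact: forallP. Qed.

Lemma norm_le (s t : vec) : vle s t -> norm s <= norm t.
Proof. by move=> /vleP st; apply: leq_sum => e _. Qed.

Lemma vle_norm_eq (s t : vec) : vle s t -> norm t <= norm s -> s = t.
Proof.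
move=> /vleP st nts; apply/ffunP => e; apply/eqP; rewrite eqn_leq st /=.
have [//|lt_e] := leqP (t e) (s e).
suff : norm s < norm t by rewrite ltnNge nts.
rewrite /norm (bigD1 e) //= [ltnRHS](bigD1 e) //=.
by rewrite -addSn leq_add // leq_sum.
Qed.

Lemma sum_pred1 (e : edge M) : \sum_(e' : edge M) (e' == e) = 1.
Proof. by rewrite (bigD1 e) //= eqxx big1 // => e' /negPf ->. Qed.

Lemma norm_add_at (z : vec) k a : norm (add_at z k a) = norm z + k.
Proof.
rewrite /norm (eq_bigr (fun e => z e + k * (e == a))); last first.
  by move=> e _; rewrite ffunE.
by rewrite big_split /= -big_distrr /= sum_pred1 muln1.
Qed.

Lemma le_add_at (z : vec) k a : vle z (add_at z k a).
Proof. by apply/vleP => e; rewrite ffunE leq_addr. Qed.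

Lemma norm_exchange (z : vec) k a c :
  k <= z c -> norm (exchange z k a c) = norm z.
Proof.
move=> zc; apply: (@addIn k); rewrite -(norm_add_at z k a).
rewrite -(norm_add_at (exchange z k a c) k c); congr norm.
by apply/ffunP => e; rewrite !ffunE; case: (e =P c) => [->|_]; lia.
Qed.

Lemma vle_norm_pred (s t : vec) : vle s t -> norm t = (norm s).+1 ->
  exists2 c, 0 < t c & s = [ffun e => t e - (e == c)].
Proof.
move=> st nts; have /vleP le_st := st.
have [c lt_c] : exists c, s c < t c.
  apply/existsP; apply: contraT; rewrite negb_exists => /forallP le_ts.
  suff : norm t <= norm s by rewrite nts ltnn.
  by apply: norm_le; apply/vleP => e; have := le_ts e; rewrite -leqNgt.
exists c; first by lia.
apply: vle_norm_eq.
  by apply/vleP => e; rewrite ffunE; case: (e =P c) => [->|_]; have := le_st e; lia.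
rewrite -ltnS -nts -addn1 -(norm_add_at _ 1 c); apply: eq_leq; congr norm.
by apply/ffunP => e; rewrite !ffunE; case: (e =P c) => [->|_]; lia.
Qed.

End Vectors.

(** * The choice function of a firm *)

Section Firm.
Variables (M : market) (wf : well_formed M) (f : firm M).
Local Notation vec := {ffun edge M -> nat}.
Local Notation B := (in_B (inr f : vertex M)).
Local Notation C := (@cfirm M f).

Lemma in_BP (z : vec) :
  reflect (forall e, z e <= cap M e /\ (ef e != f -> z e = 0)) (B z).
Proof.
apply: (iffP andP) => [[/vleP zb /eqP zf] e|zP].
  split=> // ne; by rewrite -zf ffunE /= (negPf ne).
split; first by apply/vleP => e; case: (zP e).
apply/eqP/ffunP => e; rewrite ffunE /=; case: ifPn => // ne.
by case: (zP e) => _ ->.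
Qed.

Lemma in_B_le (z z' : vec) : vle z z' -> B z' -> B z.
Proof.
move=> /vleP le_zz' /in_BP z'P; apply/in_BP => e.
by have := le_zz' e; case: (z'P e) => ? h ?; split=> [|/h]; lia.
Qed.

Lemma in_B_max (z z' : vec) : B z -> B z' -> B (vmax z z').
Proof.
move=> /in_BP zP /in_BP z'P; apply/in_BP => e; rewrite ffunE.
by case: (zP e) (z'P e) => ? h [? h']; split=> [|ne]; [lia | rewrite h ?h'].
Qed.

Lemma in_B_choice (z : vec) : B z -> B (C z).
Proof. by move=> Bz; exact: in_B_le (cfirm_le wf Bz) Bz. Qed.

Lemma choice_sandwich (z z' : vec) :
  B z -> vle (C z) z' -> vle z' z -> C z' = C z.
Proof. by move=> Bz Cz z'z; apply: (cfirm_A1 wf) => //; apply: in_B_le (Bz). Qed.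

Lemma choice_idem (z : vec) : B z -> C (C z) = C z.
Proof.
move=> Bz; apply: choice_sandwich => //; last exact: cfirm_le.
by apply/vleP.
Qed.

Lemma choice_subst (z z' : vec) e :
  B z -> vle z' z -> minn (C z e) (z' e) <= C z' e.
Proof.
move=> Bz z'z; have := cfirm_A2 wf Bz (in_B_le z'z Bz) z'z.
by move/vleP/(_ e); rewrite ffunE.
Qed.

(** Substitutability bounds C(z v z') by C(z) v z', and consistency (A1) then
    applies between the two. *)
Lemma path_independence (z z' : vec) :
  B z -> B z' -> C (vmax (C z) z') = C (vmax z z').
Proof.
move=> Bz Bz'; have Bm := in_B_max Bz Bz'.
have /vleP Czz := cfirm_le wf Bz; have /vleP Cm := cfirm_le wf Bm.
apply: choice_sandwich => //; apply/vleP => e; rewrite ?ffunE.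
  have := @choice_subst _ z e Bm; have := Cm e; rewrite ffunE.
  have: vle z (vmax z z') by apply/vleP => e'; rewrite ffunE leq_maxl.
  by move=> -> ? /(_ isT); lia.
by have := Czz e; lia.
Qed.

(** On acceptable vectors this is the relation [vpreceq] of the firm; it is
    needed for unacceptable [z] too, such as the vector from which the firm
    chooses during a shift. *)
Definition dominated (z y : vec) := C (vmax z y) = y.

Lemma vmaxxx (z : vec) : vmax z z = z.
Proof. by apply/ffunP => e; rewrite ffunE maxnn. Qed.

Lemma vmaxC (z z' : vec) : vmax z z' = vmax z' z.
Proof. by apply/ffunP => e; rewrite !ffunE maxnC. Qed.

Lemma vpreceqP (z y : vec) : C y = y ->
  reflect (dominated z y) (vpreceq (inr f) z y).
Proof.
move=> Cy; rewrite /vpreceq /vprec /dominated vmaxC.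
case: (z =P y) => [->|_] /=; first by apply: ReflectT; rewrite vmaxxx.
exact: eqP.
Qed.

Lemma choice_of_dominated (z y : vec) :
  B z -> B y -> dominated z y -> C y = y.
Proof. by move=> Bz By <-; apply: choice_idem; apply: in_B_max. Qed.

Lemma dominated_choice (z : vec) : B z -> dominated z (C z).
Proof.
move=> Bz; have /vleP h := cfirm_le wf Bz.
rewrite /dominated; congr C; apply/ffunP => e; rewrite ffunE.
by have := h e; lia.
Qed.

(** Domination may be checked one edge at a time, with a different bound for
    each edge: by substitutability, if C(z v y) exceeded [y] at [e], so would
    the choice from [y] raised at [e] only, and that vector lies below the
    maximum of [y] and the bound for [e], which makes its choice equal to
    [y]. *)
Lemma dominated_pointwise (z y : vec) : B z -> B y -> C y = y ->
  (forall e, exists z', [/\ B z', dominated z' y & z e <= z' e]) ->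
  dominated z y.
Proof.
move=> Bz By Cy zP; rewrite /dominated -[RHS]Cy; apply/esym.
have Bm := in_B_max Bz By.
apply: choice_sandwich => //; last first.
  by apply/vleP => e; rewrite ffunE leq_maxr.
apply/vleP => e; have [z' [Bz' domz' le_e]] := zP e.
pose v := set_at y e (vmax z y e).
have Cv : C v = y.
  rewrite -[RHS]domz'; apply: choice_sandwich; first exact: in_B_max.
    rewrite domz'; apply/vleP => e'; rewrite !ffunE.
    by case: eqP => [->|_]; rewrite ?leq_maxr.
  apply/vleP => e'; rewrite !ffunE.
  by case: eqP => [->|_]; lia.
have vm : vle v (vmax z y).
  by apply/vleP => e'; rewrite !ffunE; case: eqP => [->|_]; rewrite ?leq_maxr.
have := choice_subst e Bm vm; rewrite Cv ffunE eqxx.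
by have /vleP/(_ e) := cfirm_le wf Bm; lia.
Qed.

Lemma dominated_le (z z' y : vec) : B z -> B y -> C y = y ->
  vle z' z -> dominated z y -> dominated z' y.
Proof.
move=> Bz By Cy z'z domz; apply: dominated_pointwise => //.
  exact: in_B_le Bz.
by move=> e; exists z; split=> //; apply/vleP.
Qed.

Lemma dominated_of_choice (z y : vec) : B z -> B y ->
  dominated (C z) y -> dominated z y.
Proof. by move=> Bz By; rewrite /dominated path_independence. Qed.

(** C(z v z') = z' is dominated by [y], hence so is z v z'. *)
Lemma dominated_trans (z z' y : vec) : B z -> B z' -> B y ->
  dominated z z' -> dominated z' y -> dominated z y.
Proof.
move=> Bz Bz' By d d'; have Cy := choice_of_dominated Bz' By d'.
have dm : dominated (vmax z z') y.
  by apply: dominated_of_choice => //; [exact: in_B_max | rewrite d].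
apply: dominated_le dm => //; first exact: in_B_max.
by apply/vleP => e; rewrite ffunE leq_maxl.
Qed.

(** An abstract tandem with c != a, which excludes the degenerate equality
    C(y + 1^a) = y + 1^a - 1^a expressing that [a] is rejected. *)
Definition exchanges (y : vec) (a c : edge M) :=
  [/\ ef a = f /\ ef c = f, c != a, y a < cap M a, 0 < y c &
      C (add_at y 1 a) = exchange y 1 a c].

Lemma in_B_add (y : vec) a k :
  B y -> ef a = f -> y a + k <= cap M a -> B (add_at y k a).
Proof.
move=> /in_BP yP fa ya; apply/in_BP => e; rewrite ffunE.
have [yb yf] := yP e; split.
  by case: eqP => [->|_]; lia.
move=> ne; rewrite (yf ne); case: eqP => [ea|_]; last by rewrite muln0.
by rewrite ea fa eqxx in ne.
Qed.

(** Otherwise y + 1^a lies between y = C(z v y) and z v y, and [a] would be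
    rejected. *)
Lemma exchanges_mono (z y : vec) a c : B z -> B y -> dominated z y ->
  exchanges y a c -> z a <= y a.
Proof.
move=> Bz By d [[fa _] /negPf ca _ _ Cya]; rewrite leqNgt; apply/negP => lt_a.
have : C (add_at y 1 a) = C (vmax z y).
  apply: choice_sandwich; first exact: in_B_max.
    by rewrite d; apply/vleP => e; rewrite ffunE leq_addr.
  by apply/vleP => e; rewrite !ffunE; case: eqP => [->|_]; lia.
rewrite Cya d => /ffunP/(_ a); rewrite ffunE eqxx eq_sym ca; lia.
Qed.

(** z v w = (z v y) v w, and [y] is the choice from z v y. *)
Lemma choice_absorb (z y w : vec) :
  B z -> B w -> dominated z y -> vle y w -> C (vmax z w) = C w.
Proof.
move=> Bz Bw d yw; have By := in_B_le yw Bw.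
have /vleP h := yw.
have -> : vmax z w = vmax (vmax z y) w.
  by apply/ffunP => e; rewrite !ffunE; have := h e; lia.
rewrite -path_independence //; last exact: in_B_max.
by rewrite d; congr C; apply/ffunP => e; rewrite !ffunE; have := h e; lia.
Qed.

(** If one more unit of [a] is rejected at [z], then so is any number of them,
    hence [z] raised to y(a) + 1 at [a] has choice [z] and is dominated by
    [y].  By [dominated_pointwise] so is y + 1^a. *)
Lemma rejected_stays_rejected (z y : vec) a :
  B z -> C z = z -> B y -> dominated z y -> z a <= y a -> y a < cap M a ->
  ef a = f -> C (add_at z 1 a) = z -> C (add_at y 1 a) = y.
Proof.
move=> Bz Cz By d le_a ya fa Cza; have Cy := choice_of_dominated Bz By d.
have By1 : B (add_at y 1 a) by apply: in_B_add => //; lia.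
pose zm := add_at z ((y a).+1 - z a) a.
have Bzm : B zm by apply: in_B_add => //; lia.
have Czm : C zm = z.
  rewrite -[RHS]Cz; apply/esym/choice_sandwich => //.
    apply/vleP => e; have /vleP/(_ e) := cfirm_le wf Bzm.
    rewrite ffunE; case: (e =P a) => [->|_]; last by lia.
    have : vle (add_at z 1 a) zm.
      by apply/vleP => e'; rewrite !ffunE; case: eqP => [->|_]; lia.
    by move/(choice_subst a Bzm); rewrite Cza ffunE eqxx; lia.
  by apply/vleP => e; rewrite ffunE leq_addr.
have dm : dominated zm y by apply: dominated_of_choice => //; rewrite Czm.
have : dominated (add_at y 1 a) y.
  apply: dominated_pointwise => // e; rewrite ffunE.
  case: (e =P a) => [->|_].
    by exists zm; split=> //; rewrite ffunE eqxx; lia.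
  by exists y; split=> //; rewrite /dominated ?vmaxxx //; lia.
rewrite /dominated => {2}<-; congr C; apply/ffunP => e; rewrite !ffunE; lia.
Qed.

(** The choice from z + 1^a has at least |z| elements by monotonicity from [z],
    and at most |y| = |z| because z + 1^a lies below z v (y + 1^a), whose choice
    is that from y + 1^a.  So exactly one unit is discarded, and it is not of
    [a] by [rejected_stays_rejected]. *)
Lemma exchanges_persist (z y : vec) a c : B z -> C z = z -> B y ->
  dominated z y -> norm z = norm y -> exchanges y a c ->
  exists c', exchanges z a c'.
Proof.
move=> Bz Cz By d nzy ex; have le_a := exchanges_mono Bz By d ex.
case: ex => -[fa fc] /negPf ca ya yc Cya; have Cy := choice_of_dominated Bz By d.
have za : z a < cap M a by lia.
have Bz1 : B (add_at z 1 a) by apply: in_B_add => //; lia.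
have By1 : B (add_at y 1 a) by apply: in_B_add => //; lia.
set t := C (add_at z 1 a).
have tz : vle t (add_at z 1 a) by apply: cfirm_le.
have nt : norm (add_at z 1 a) = (norm t).+1.
  rewrite norm_add_at addn1; congr S; apply/eqP; rewrite eqn_leq; apply/andP; split.
    rewrite -{1}Cz; apply: (cfirm_A3 wf) => //.
    by apply/vleP => e; rewrite ffunE leq_addr.
  rewrite nzy -(norm_exchange a yc) -Cya.
  rewrite -(choice_absorb Bz By1 d); last first.
    by apply/vleP => e; rewrite ffunE leq_addr.
  apply: (cfirm_A3 wf) => //; first exact: in_B_max.
  by apply/vleP => e; rewrite !ffunE; case: eqP => [->|_]; lia.
have [c' c'1 tE] := vle_norm_pred tz nt.
have c'a : c' != a.
  apply/eqP => c'a; have Cza : C (add_at z 1 a) = z.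
    by rewrite -/t tE c'a; apply/ffunP => e; rewrite !ffunE; lia.
  have := rejected_stays_rejected Bz Cz By d le_a ya fa Cza.
  by rewrite Cya => /ffunP/(_ a); rewrite ffunE eqxx eq_sym ca; lia.
have zc' : 0 < z c' by move: c'1; rewrite ffunE (negPf c'a); lia.
exists c'; split=> //; first split=> //.
  apply/eqP; apply: contraLR zc' => ne.
  by move/in_BP: Bz => /(_ c') [_ ->].
by rewrite -/t tE; apply/ffunP => e; rewrite !ffunE !mul1n.
Qed.

(** z + (k + 1) 1^a is the maximum of z + k 1^a and u + 1^a, where [u] is the
    choice from the former; path independence reduces the choice from it to the
    choice from u + 1^a. *)
Lemma exchanges_iterate (z : vec) k a c : B z ->
  C (add_at z k a) = exchange z k a c -> exchanges (exchange z k a c) a c ->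
  C (add_at z k.+1 a) = exchange z k.+1 a c.
Proof.
move=> Bz Ck [[fa fc] /negPf ca ua uc Cu].
have {}ua : z a + k < cap M a by move: ua; rewrite ffunE eqxx eq_sym ca; lia.
have {}uc : k < z c by move: uc; rewrite ffunE eqxx ca; lia.
have Bk : B (add_at z k a) by apply: in_B_add => //; lia.
set u := exchange z k a c in Ck Cu.
have Bu : B u by rewrite -Ck; apply: in_B_choice.
have Bu1 : B (add_at u 1 a).
  by apply: in_B_add => //; rewrite ffunE eqxx eq_sym ca; lia.
have -> : add_at z k.+1 a = vmax (add_at z k a) (add_at u 1 a).
  apply/ffunP => e; rewrite !ffunE; case: (e =P a) => [->|_].
    by rewrite eq_sym ca; lia.
  by case: (e =P c); lia.
rewrite -path_independence // Ck.
have -> : vmax u (add_at u 1 a) = add_at u 1 a.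
  by apply/ffunP => e; rewrite !ffunE; lia.
rewrite Cu; apply/ffunP => e; rewrite !ffunE; lia.
Qed.

End Firm.

(** * Shifting along a rotation *)

Section Shift.
Variables (M : market) (wf : well_formed M).
Local Notation vec := {ffun edge M -> nat}.
Local Notation at_firm f x := (restr (inr f : vertex M) x).

Lemma stable_at_firm f (x : vec) : stable x ->
  in_B (inr f) (at_firm f x) /\ cfirm f (at_firm f x) = at_firm f x.
Proof.
by case/andP => /andP[_ /forallP/(_ (inr f))] /andP[Bx /eqP Cx] _.
Qed.

Lemma at_firmE f (x : vec) e : ef e = f -> at_firm f x e = x e.
Proof. by move=> fe; rewrite ffunE /= fe eqxx. Qed.

Lemma tandem_exchanges f (x : vec) a c : ef a = f -> tandem x a c ->
  exchanges f (at_firm f x) a c.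
Proof.
move=> <- /and5P[/andP[Wa _] /eqP fc ca xc /eqP Ca]; split=> //.
case/and4P: Wa => _ _ _ /andP[_ /existsP[k /andP[xk _]]].
by apply: leq_trans xk _; rewrite -ltnS.
Qed.

Definition uses (L : seq (dedge M)) (a c : edge M) : bool :=
  (inl a \in L) && (next L (inl a) == inr c).

Lemma rotation_uniq (x : vec) L : rotation x L -> uniq L.
Proof. by case/existsP => G /andP[_ /and4P[]]. Qed.

Lemma rotation_cycle (x : vec) L : rotation x L -> cycle (consecutive x) L.
Proof. by case/existsP => G /andP[_ /and4P[]]. Qed.

Lemma rotation_tandem (x : vec) L a c :
  rotation x L -> uses L a c -> tandem x a c.
Proof.
move=> /rotation_cycle cL /andP[aL /eqP nx].
by have := next_cycle cL aL; rewrite nx.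
Qed.

Lemma uses_plus (x : vec) L a : rotation x L -> inl a \in L ->
  exists c, uses L a c.
Proof.
move=> /rotation_cycle cL aL; have := next_cycle cL aL.
by case nx: (next L (inl a)) => [//|c] _; exists c; rewrite /uses aL nx eqxx.
Qed.

Lemma uses_minus (x : vec) L c : rotation x L -> inr c \in L ->
  exists a, uses L a c.
Proof.
move=> rL cL; have := prev_cycle (rotation_cycle rL) cL.
case pv: (prev L (inr c)) => [a|//] _; exists a; rewrite /uses -pv mem_prev cL.
by rewrite next_prev ?eqxx //; apply: rotation_uniq rL.
Qed.

(** What the firms choose from during a shift: L^+ is raised, and L^- is not yet
    reduced. *)
Definition offer (x : vec) (L : seq (dedge M)) (k : nat) : vec :=
  [ffun e => x e + k * (e \in Lplus L)].

Section AtFirm.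
Variables (f : firm M) (x : vec) (L : seq (dedge M)) (k : nat).
Hypotheses (xS : stable x) (rL : rotation x L) (Fk : feasible x L k).
Local Notation xf := (at_firm f x).
Local Notation plus := [set e in Lplus L | ef e == f].
Local Notation minus := [set e in Lminus L | ef e == f].

(** Following L by one edge injects the first set into the second. *)
Lemma card_plus_minus : #|plus| <= #|minus|.
Proof.
pose h e := if next L (inl e) is inr c then c else e.
have hP e : inl e \in L -> next L (inl e) = inr (h e).
  by move=> /(uses_plus rL)[c /andP[_ /eqP nx]]; rewrite /h nx.
rewrite -(card_in_imset (f := h) (D := plus)).
  apply/subset_leq_card/subsetP => c /imsetP[a]; rewrite !inE => /andP[aL fa] ->.
  have u : uses L a (h a) by apply/andP; split=> //; apply/eqP/hP.
  have /and5P[_ /eqP -> _ _ _] := rotation_tandem rL u; rewrite fa andbT.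
  by rewrite -hP // mem_next.
move=> a a'; rewrite !inE => /andP[aL _] /andP[a'L _] eq_h.
have := hP _ aL; rewrite eq_h -hP //.
by move/(can_inj (prev_next (rotation_uniq rL))) => -[].
Qed.

Lemma in_B_offer : in_B (inr f) (at_firm f (offer x L k)).
Proof.
have [/(in_BP)xP _] := stable_at_firm f xS.
case: Fk => _ _ cp _; apply/in_BP => e; have [xb xn] := xP e.
rewrite !ffunE /=; case: ifP => fe; last by split.
rewrite at_firmE in xb; last exact/eqP.
split=> //; case: (boolP (e \in _)) => [/cp|_]; lia.
Qed.

(** By substitutability the firm discards at least [k] units of every edge of
    L^- at [f], as each of these is discarded already when only its partner is
    raised.  L has as many edges of L^- as of L^+ at [f], so the choice from the
    offer has size at most |x_f|, with equality only if L^+ and L^- are disjoint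
    at [f].  By (A3) its size is at least |x_f|, hence nothing else is
    discarded. *)
Lemma offer_shift :
  [/\ cfirm f (at_firm f (offer x L k)) = at_firm f (shift x L k),
      norm (at_firm f (shift x L k)) = norm xf &
      forall e, ef e = f -> e \in Lplus L -> e \notin Lminus L].
Proof.
have BZ := in_B_offer; set Z := at_firm f (offer x L k) in BZ *.
have [Bx Cx] := stable_at_firm f xS; have [k0 km kp Ck] := Fk.
have ZE e : Z e = xf e + k * (e \in plus).
  by rewrite !ffunE /= inE andbC; case: eqP => _ /=; rewrite ?muln0.
(* [T] is the bound on the choice just described; [nT] counts its size, with a
   deficit of [k] for each edge lying in both L^+ and L^-. *)
pose T : vec := [ffun e => if e \in minus then xf e - k else Z e].
have kx e : e \in minus -> k <= xf e.
  by rewrite inE => /andP[/km ke /eqP fe]; rewrite at_firmE.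
have CT : vle (cfirm f Z) T.
  apply/vleP => e; rewrite ffunE; case: ifP => [|_]; last first.
    by have /vleP := cfirm_le wf BZ.
  rewrite 2!inE => /andP[eL /eqP fe]; have [a ae] := uses_minus rL eL.
  have /and5P[_ /eqP fa ea _ _] := rotation_tandem rL ae.
  have [aL /eqP nx] := andP ae.
  have Zx : vle (add_at xf k a) Z.
    apply/vleP => e'; rewrite ZE ffunE; case: (e' =P a) => [->|_]; last by lia.
    by rewrite !inE aL -fa fe eqxx.
  have := choice_subst wf e BZ Zx; have := Ck a e aL nx.
  rewrite -fa fe => ->; rewrite !ffunE eqxx (negPf ea).
  by have := kx e; rewrite !inE eL fe eqxx => /(_ isT); rewrite !ffunE; lia.
have cardE (S : {set edge M}) : #|S| = \sum_e (e \in S).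
  by rewrite -sum1_card big_mkcond; apply: eq_bigr => e _; case: ifP.
have nT : norm T + k * #|minus| + k * #|plus :&: minus| = norm xf + k * #|plus|.
  rewrite !cardE /norm !big_distrr -!big_split /=; apply: eq_bigr => e _.
  rewrite ffunE ZE (in_setI e plus).
  by case: (e \in minus) (kx e) => [/(_ isT)|_]; case: (e \in plus) => /=; lia.
have nC : norm xf <= norm (cfirm f Z).
  rewrite -{1}Cx; apply: (cfirm_A3 wf) => //.
  by apply/vleP => e; rewrite ZE leq_addr.
have nCT := norm_le CT.
have := card_plus_minus; rewrite -(leq_pmul2l k0) => le_pm.
have /eqP : k * #|plus :&: minus| = 0 by lia.
rewrite muln_eq0 eqn0Ngt k0 /= cards_eq0 => /eqP pm0.
have CE : cfirm f Z = T by apply: vle_norm_eq => //; lia.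
have disj e : ef e = f -> e \in Lplus L -> e \notin Lminus L.
  move=> fe ep; apply/negP => em; have : e \in plus :&: minus.
    by rewrite inE !in_set fe eqxx; move: ep em; rewrite !in_set => -> ->.
  by rewrite pm0 inE.
have TE : T = at_firm f (shift x L k).
  apply/ffunP => e; rewrite ffunE ZE !ffunE /=.
  have := disj e; rewrite !in_set.
  case: (ef e =P f) => fe; last by rewrite !andbF muln0.
  rewrite !andbT => /(_ fe); case: (inl e \in L) => [/(_ isT)/negPf ->|_].
    by rewrite muln0 subn0.
  by case: ifP => _; lia.
split=> //; first by rewrite CE.
by rewrite -TE -CE; lia.
Qed.
End AtFirm.
End Shift.

(** * Non-excessive routes *)

Section Route.
Variables (M : market) (wf : well_formed M) (gap : gapless M).
Variables (x y : {ffun edge M -> nat}) (N : nat).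
Variables (xs : nat -> {ffun edge M -> nat}) (Ls : nat -> seq (dedge M)).
Variables (ks : nat -> nat).
Hypothesis route_xy : non_excessive_route x y N xs Ls ks.
Local Notation at_firm f x := (restr (inr f : vertex M) x).

Lemma route_stable i : i < N -> stable (xs i).
Proof. by case: route_xy => -[_ _ + _] _; apply. Qed.

Lemma route_step i : i.+1 < N ->
  [/\ rotation (xs i) (Ls i), feasible (xs i) (Ls i) (ks i) &
      xs i.+1 = shift (xs i) (Ls i) (ks i)].
Proof. by case: route_xy => -[_ _ _ +] _; apply. Qed.

Lemma in_B_route f i : i < N -> in_B (inr f) (at_firm f (xs i)).
Proof. by move=> /route_stable/(stable_at_firm f)[]. Qed.

Lemma choice_route f i :
  i < N -> cfirm f (at_firm f (xs i)) = at_firm f (xs i).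
Proof. by move=> /route_stable/(stable_at_firm f)[]. Qed.

Lemma dominated_offer f i : i.+1 < N ->
  dominated f (at_firm f (offer (xs i) (Ls i) (ks i))) (at_firm f (xs i.+1)).
Proof.
move=> iN; have [rL Fk ->] := route_step iN.
have xS := route_stable (ltnW iN).
have [<- _ _] := offer_shift wf f xS rL Fk.
exact/dominated_choice/in_B_offer.
Qed.

Lemma le_offer f (z : {ffun edge M -> nat}) L k :
  vle (at_firm f z) (at_firm f (offer z L k)).
Proof. by apply/vleP => e; rewrite !ffunE /=; case: ifP => // _; lia. Qed.

Lemma in_B_route_offer f i : i.+1 < N ->
  in_B (inr f) (at_firm f (offer (xs i) (Ls i) (ks i))).
Proof.
move=> iN; have [rL Fk _] := route_step iN.
by apply: in_B_offer => //; apply/route_stable/ltnW.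
Qed.

(** A firm's vector after a step is its choice from an offer above its vector
    before the step, so firms only improve along the route. *)
Lemma route_dominated f i j : i <= j -> j < N ->
  dominated f (at_firm f (xs i)) (at_firm f (xs j)).
Proof.
move=> /subnKC <-; elim: (j - i) => [|d IHd]; rewrite ?addnS ?addn0 => jN.
  by rewrite /dominated vmaxxx choice_route.
have jN' := ltnW jN.
apply: dominated_trans (IHd jN') _ => //; try exact: in_B_route.
  by apply: in_B_route; lia.
apply: dominated_le (dominated_offer f jN) => //.
- exact: in_B_route_offer.
- exact: in_B_route.
- exact: choice_route.
- exact: le_offer.
Qed.

Lemma route_norm f i : i < N -> norm (at_firm f (xs i)) = norm (at_firm f (xs 0)).
Proof.
elim: i => // i IHi iN; rewrite -(IHi (ltnW iN)).
have [rL Fk ->] := route_step iN.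
by have [] := offer_shift wf f (route_stable (ltnW iN)) rL Fk.
Qed.

(** A pair used at steps i < j stays exchangeable after the firm has taken the
    [ks i] units of step [i] on this pair alone.  The gapless condition is
    applied to x^i, this intermediate vector and x^j. *)
Lemma recurrent_exchanges i j a c : i < j -> j.+1 < N ->
  uses (Ls i) a c -> uses (Ls j) a c ->
  let f := ef a in
  exchanges f (exchange (at_firm f (xs i)) (ks i) a c) a c
  /\ xs i a + ks i <= xs j a.
Proof.
move=> ij jN ui uj f; have iN : i.+1 < N by lia.
have [rL Fk xsi1] := route_step iN; have [rLj _ _] := route_step jN.
set xf := at_firm f (xs i); set k := ks i; set u := exchange _ _ _ _.
set yf := at_firm f (xs j).
have Bx : in_B (inr f) xf by apply/in_B_route/ltnW.
have By : in_B (inr f) yf by apply/in_B_route/ltnW.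
have Cy : cfirm f yf = yf by apply/choice_route/ltnW.
have ex : exchanges f xf a c by apply/tandem_exchanges/(rotation_tandem rL).
have ey : exchanges f yf a c by apply/tandem_exchanges/(rotation_tandem rLj).
have [[_ fc] /negPf ca _ xc _] := ex.
have [aL /eqP nx] := andP ui.
have [k0 km kp /(_ a c aL nx) uE] := Fk.
have cL : c \in Lminus (Ls i) by rewrite inE -nx mem_next.
have Z1 : vle (add_at xf k a) (at_firm f (offer (xs i) (Ls i) k)).
  apply/vleP => e; rewrite !ffunE /= inE; case: (e =P a) => [->|_].
    by rewrite /f eqxx aL.
  by case: ifP => _; lia.
have BZ := in_B_route_offer f iN.
have B1 : in_B (inr f) (add_at xf k a) := in_B_le Z1 BZ.
have Bu : in_B (inr f) u by rewrite /u -uE; apply: in_B_choice.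
have Cu : cfirm f u = u by rewrite /u -uE; apply: choice_idem.
have Bi1 := in_B_route f iN.
have duy : dominated f u yf.
  apply: (@dominated_trans _ wf f u (at_firm f (xs i.+1))) => //; last first.
    by apply: route_dominated => //; apply: ltnW.
  apply: dominated_le (dominated_offer f iN) => //; first exact: choice_route.
  apply/vleP => e; apply: leq_trans (vleP _ _ Z1 e).
  by rewrite /u -uE; apply/vleP/cfirm_le.
have dxu : dominated f xf u.
  apply: (@dominated_le _ wf f (add_at xf k a)) => //.
    exact: le_add_at.
  by rewrite /u -uE; apply: dominated_choice.
have xfc : xf c = xs i c by apply: at_firmE.
have nu : norm u = norm yf.
  rewrite norm_exchange; last by rewrite xfc; apply: km.
  by rewrite (route_norm f (ltnW iN)) [RHS]route_norm // ltnW.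
have ua : u a = xs i a + k.
  by rewrite ffunE eqxx eq_sym ca at_firmE // muln1 muln0 subn0.
have [c' eu] := exchanges_persist wf Bu Cu By duy nu ey.
split; last first.
  by rewrite -ua -(at_firmE (f := f) (xs j)) //; apply: exchanges_mono ey.
have [-> //|neq_uy] := eqVneq u yf.
have xu : vprec (inr f) xf u.
  have /vpreceqP := dxu; move/(_ Cu)/orP => -[/eqP xu|//].
  move: ua k0; rewrite -xu at_firmE // lt0n -/k -[X in X = _]addn0.
  by move/addnI => <-.
have uy : vprec (inr f) u yf.
  by have /vpreceqP := duy; move/(_ Cy)/orP => -[/eqP /eqP|//]; rewrite (negPf neq_uy).
have acc z : in_B (inr f) z -> cfirm f z = z -> acceptable (inr f) z.
  by move=> Bz Cz; rewrite /acceptable Bz /= Cz eqxx.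
have abs z c0 : exchanges f z a c0 -> abstract_tandem f z a c0.
  by case=> -[? ?] *; split.
suff -> : c = c' by [].
apply: (gap (acc _ Bx _) (acc _ Bu Cu) (acc _ By Cy) xu uy) => //.
- exact/choice_route/ltnW.
- exact: abs ex.
- exact: abs eu.
- exact: abs ey.
Qed.

Lemma route_raise j a : j.+1 < N -> inl a \in Ls j -> xs j a < xs j.+1 a.
Proof.
move=> jN aL; have [rL Fk ->] := route_step jN; have [k0 _ _ _] := Fk.
have [_ _ disj] := offer_shift wf (ef a) (route_stable (ltnW jN)) rL Fk.
have ap : a \in Lplus (Ls j) by rewrite inE.
by rewrite ffunE ap (negPf (disj _ erefl ap)); lia.
Qed.

(** If every pair of L^i recurred, weight [ks i] + 1 would be feasible at step
    [i] and the shift would remain below [y]. *)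
Lemma exists_last_use i : i.+1 < N ->
  exists p : edge M * edge M, uses (Ls i) p.1 p.2 /\
    forall j, i < j -> j.+1 < N -> ~~ uses (Ls j) p.1 p.2.
Proof.
move=> iN; pose last_use (p : edge M * edge M) := uses (Ls i) p.1 p.2 &&
  [forall j : 'I_N, (i < j) && (j.+1 < N) ==> ~~ uses (Ls j) p.1 p.2].
have [/existsP[p /andP[up /forallP lp]]|] := boolP [exists p, last_use p].
  exists p; split=> // j ij jN.
  by have /implyP := lp (Ordinal (ltnW jN)); apply; rewrite ij.
rewrite negb_exists => /forallP no_last; exfalso.
have [rL Fk xsi1] := route_step iN.
have xS := route_stable (ltnW iN).
have recur a c : uses (Ls i) a c ->
    exists j, [/\ i < j, j.+1 < N & uses (Ls j) a c].
  move=> u; have := no_last (a, c); rewrite /last_use u /= negb_forall.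
  case/existsP => j; rewrite negb_imply negbK => /andP[/andP[ij jN] uj].
  by exists j.
have ex a c : uses (Ls i) a c -> let f := ef a in
    exchanges f (exchange (at_firm f (xs i)) (ks i) a c) a c.
  by move=> u; have [j [ij jN uj]] := recur a c u;
     have [] := recurrent_exchanges ij jN u uj.
have [k0 km kp Ck] := Fk.
have Fk1 : feasible (xs i) (Ls i) (ks i).+1.
  split=> // [e eL|e eL|a c aL nx].
  - rewrite inE in eL; have [a u] := uses_minus rL eL.
    have [[_ fc] /negPf ca _ + _] := ex _ _ u.
    by rewrite ffunE at_firmE // eqxx ca; lia.
  - rewrite inE in eL; have [c u] := uses_plus rL eL.
    have [_ /negPf ca + _ _] := ex _ _ u.
    by rewrite ffunE at_firmE // eqxx eq_sym ca; lia.
  have u : uses (Ls i) a c by rewrite /uses aL nx eqxx.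
  exact: exchanges_iterate (in_B_route _ (ltnW iN)) (Ck a c aL nx) (ex a c u).
have [_ _ max] := (proj2 route_xy) i iN.
suff /(max _ Fk1) : preceqF (shift (xs i) (Ls i) (ks i).+1) y by rewrite ltnn.
have yE : y = xs N.-1 by case: route_xy => -[_ [_ ->]].
have NN : N.-1 < N by lia.
rewrite /preceqF /precF; case: eqP => //= _; apply/forallP => f.
rewrite yE; apply/vpreceqP; first exact: choice_route.
have BZ := in_B_offer f xS rL Fk1.
have [<- _ _] := offer_shift wf f xS rL Fk1.
have Cy := choice_route f NN; have By := in_B_route f NN.
apply: (dominated_le wf BZ By Cy); first exact: cfirm_le.
apply: dominated_pointwise => // e.
have [fe|ne] := eqVneq (ef e) f; last first.
  exists (at_firm f (xs i)); split; first exact/in_B_route/ltnW.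
    by apply: route_dominated => //; lia.
  by rewrite !ffunE /= (negPf ne).
have [eL|eL] := boolP (e \in Lplus (Ls i)); last first.
  exists (at_firm f (xs i)); split; first exact/in_B_route/ltnW.
    by apply: route_dominated => //; lia.
  by rewrite !ffunE (negPf eL) muln0 addn0.
(* At its next use the edge [e] starts from at least the value reached after
   step [i], and gains at least one more unit. *)
have [c u] : exists c, uses (Ls i) e c by apply: uses_plus rL _; rewrite inE in eL.
have [j [ij jN uj]] := recur e c u.
exists (at_firm f (xs j.+1)); split; first exact: in_B_route.
  by apply: route_dominated => //; lia.
rewrite !at_firmE // ffunE eL muln1 addnS.
apply: leq_ltn_trans (route_raise jN (proj1 (andP uj))).
by have [] := recurrent_exchanges ij jN u uj.
Qed.

Lemma route_nontrivial : 1 < N.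
Proof.
case: route_xy => -[[_ _ /andP[xy _]] [x0 xN] _ _] _.
by case: N xN => [|[|n]] //= yx; rewrite -x0 -yx eqxx in xy.
Qed.

End Route.

Lemma uses_same_rotation (M : market) (L L' : seq (dedge M)) a c :
  uniq L -> same_rotation L L' -> uses L' a c = uses L a c.
Proof. by move=> uL [n ->]; rewrite /uses mem_rot next_rot. Qed.

Theorem theorem4p3 :
  (forall (M : market) (x y : {ffun edge M -> nat}) (N : nat)
      (xs : nat -> {ffun edge M -> nat}) (Ls : nat -> seq (dedge M))
      (ks : nat -> nat),
    well_formed M -> gapless M -> non_excessive_route x y N xs Ls ks ->
    forall i j : nat, i.+1 < N -> j.+1 < N ->
      same_rotation (Ls i) (Ls j) -> i = j)
  /\
  (exists K : nat,
    forall (M : market) (x y : {ffun edge M -> nat}) (N : nat)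
      (xs : nat -> {ffun edge M -> nat}) (Ls : nat -> seq (dedge M))
      (ks : nat -> nat),
    well_formed M -> gapless M -> non_excessive_route x y N xs Ls ks ->
    N <= K * #|{: vertex M}| * #|edge M| ^ 2).
Proof.
split=> [M x y N xs Ls ks wf gap NE i j iN jN same|].
  have uL : uniq (Ls i).
    by have [rL _ _] := route_step NE iN; apply: rotation_uniq rL.
  case: (ltngtP i j) => // ij.
    have [p [up lp]] := exists_last_use wf gap NE iN.
    by have := lp j ij jN; rewrite (uses_same_rotation _ _ uL same) up.
  have [p [up lp]] := exists_last_use wf gap NE jN.
  by have := lp i ij iN; rewrite -(uses_same_rotation _ _ uL same) up.
exists 1 => M x y N xs Ls ks wf gap NE; rewrite mul1n.
have N1 := route_nontrivial NE.
have last_use (i : 'I_N.-1) : exists p : edge M * edge M,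
    uses (Ls i) p.1 p.2 &&
    [forall j : 'I_N.-1, (i < j) ==> ~~ uses (Ls j) p.1 p.2].
  have iN : i.+1 < N by have := ltn_ord i; lia.
  have [p [up lp]] := exists_last_use wf gap NE iN.
  exists p; rewrite up; apply/forallP => j; apply/implyP => ij.
  by apply: lp => //; have := ltn_ord j; lia.
pose last_pair i := xchoose (last_use i).
have inj : injective last_pair.
  move=> i j eq_ij; apply/val_inj.
  have /andP[ui /forallP li] := xchooseP (last_use i).
  have /andP[uj /forallP lj] := xchooseP (last_use j).
  rewrite -/(last_pair i) eq_ij in ui li; rewrite -/(last_pair j) in uj lj.
  case: (ltngtP i j) => // ij.
    by have /implyP/(_ ij) := li j; rewrite uj.
  by have /implyP/(_ ij) := lj i; rewrite ui.
have := leq_card _ inj; rewrite card_ord card_prod mulnn => leN.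
have [p _] := last_use (Ordinal (n := N.-1) (m := 0) ltac:(lia)).
have V2 : 1 < #|{: vertex M}|.
  rewrite card_sum; have : 0 < #|worker M| by apply/card_gt0P; exists (ew p.1).
  by have : 0 < #|firm M| by [apply/card_gt0P; exists (ef p.1)]; lia.
have := leq_mul V2 (leqnn (#|edge M| ^ 2)); lia.
Qed.
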